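(* Let $d\ge 2$, $n\ge 2$, and let $\mathcal{A}=\{1,\dots,d^2\}$. Any orthogonal array $M=(m_{kj})$ with parameters $OA_\lambda(n,N)$ over $\mathcal{A}$ ($\lambda\ge 1$) can be used to decouple a quantum network of $n$ nodes of dimension $d$ with $N$ local operations, in the following sense. Let $\mathcal{E}_k=\{E^k_i\mid i=1,\dots,d^2\}$, $k=1,\dots,n$, be unitary error bases of $\mathbb{C}^{d\times d}$, and put $U_j:=E^1_{m_{1j}}\otimes E^2_{m_{2j}}\otimes\cdots\otimes E^n_{m_{nj}}$ for $j=1,\dots,N$. Then for every pair-interaction Hamiltonian $H$ on $(\mathbb{C}^d)^{\otimes n}$, $$\frac1N\sum_{j=1}^N U_j^\dagger H U_j=0 .$$
   Context: Let $\{\sigma_\alpha\mid\alpha=1,\dots,d^2-1\}$ be an orthogonal basis (trace inner product) of the real vector space of traceless Hermitian operators on $\mathbb{C}^d$, and let $\sigma^k_\alpha$ be the operator on $(\mathbb{C}^d)^{\otimes n}$ acting as $\sigma_\alpha$ on the $k$-th tensor factor (node) and as the identity elsewhere. A pair-interaction Hamiltonian is an operator $H=\sum_{k\ne l}\sum_{\alpha,\beta}J_{kl;\alpha\beta}\sigma^k_\alpha\sigma^l_\beta+\sum_{k}\sum_\alpha r_{k;\alpha}\sigma^k_\alpha$ with real coefficients and $J_{kl;\alpha\beta}=J_{lk;\beta\alpha}$. A unitary error basis of $\mathbb{C}^{d\times d}$ is a collection of $d^2$ unitary $d\times d$ matrices that are pairwise orthogonal with respect to the inner product $\langle A|B\rangle=\mathrm{tr}(A^\dagger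 B)/d$. An orthogonal array $OA_\lambda(n,N)$ (strength 2, index $\lambda$) over a finite alphabet $\mathcal{A}$ is an $n\times N$ array $M=(m_{kj})$ with entries in $\mathcal{A}$ such that for all $1\le k<l\le n$ each pair in $\mathcal{A}\times\mathcal{A}$ occurs exactly $\lambda$ times in the list $((m_{kj},m_{lj})\mid j=1,\dots,N)$. *)

(* Defs.v *)
From mathcomp Require Import all_boot all_order all_algebra.
From mathcomp Require Import complex reals.

Set Implicit Arguments.
Unset Strict Implicit.
Unset Printing Implicit Defensive.

Import Order.TTheory GRing.Theory Num.Theory.
Local Open Scope ring_scope.
Local Open Scope complex_scope.
Local Open Scope sesquilinear_scope.

(* The standard basis of (C^d)^{\otimes n} is indexed by the words
   {ffun 'I_n -> 'I_d}; operators are matrices over the enumeration of these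
   words. *)
Definition tdim (n d : nat) : nat := #|{ffun 'I_n -> 'I_d}|.

(* The Kronecker product A 0 \otimes ... \otimes A (n - 1), whose (x, y) entry
   is the product over the factors k of the entries A k (x k) (y k). *)
Definition tens (K : comPzRingType) (n d : nat) (A : 'I_n -> 'M[K]_d) :
    'M[K]_(tdim n d) :=
  \matrix_(x, y) \prod_(k < n)
     A k ((enum_val x : {ffun 'I_n -> 'I_d}) k)
         ((enum_val y : {ffun 'I_n -> 'I_d}) k).

Definition on_node (K : comPzRingType) (n d : nat) (k : 'I_n) (A : 'M[K]_d) :
    'M[K]_(tdim n d) :=
  tens (fun i : 'I_n => if i == k then A else 1%:M).

Definition traceless_hermitian (K : numClosedFieldType) (d : nat)
    (A : 'M[K]_d) : bool :=
  (A \is hermsymmx) && (\tr A == 0).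

(* Existence of the real coefficients c is spanning over the reals; their
   uniqueness is linear independence over the reals. *)
Definition orthogonal_traceless_basis (R : rcfType) (d : nat)
    (s : 'I_(d ^ 2).-1 -> 'M[R[i]]_d) : Prop :=
  [/\ forall a, traceless_hermitian (s a),
      forall a b, a != b -> \tr ((s a)^t* *m s b) = 0
    & forall A : 'M[R[i]]_d, traceless_hermitian A ->
        exists! c : {ffun 'I_(d ^ 2).-1 -> R},
          A = \sum_a (c a)%:C *: s a].

Definition pair_interaction (R : rcfType) (n d : nat)
    (s : 'I_(d ^ 2).-1 -> 'M[R[i]]_d) (H : 'M[R[i]]_(tdim n d)) : Prop :=
  exists (J : 'I_n -> 'I_n -> 'I_(d ^ 2).-1 -> 'I_(d ^ 2).-1 -> R)
         (r : 'I_n -> 'I_(d ^ 2).-1 -> R),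
    (forall k l a b, J k l a b = J l k b a) /\
    H = \sum_(k < n) \sum_(l < n | k != l) \sum_a \sum_b
          (J k l a b)%:C *: (on_node k (s a) *m on_node l (s b))
        + \sum_(k < n) \sum_a (r k a)%:C *: on_node k (s a).

Definition unitary_error_basis (K : numClosedFieldType) (d : nat)
    (E : 'I_(d ^ 2) -> 'M[K]_d) : Prop :=
  (forall i, E i \is unitarymx) /\
  (forall i j, i != j -> \tr ((E i)^t* *m E j) / d%:R = 0).

Definition orthogonal_array (T : finType) (lambda n N : nat)
    (M : 'M[T]_(n, N)) : Prop :=
  forall (k l : 'I_n), (k < l)%N -> forall a b : T,
    #|[set j : 'I_N | (M k j == a) && (M l j == b)]| = lambda.

(* Main.v *)
(* Conjugation by a tensor product of unitaries acts on each factor separately.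
   Summing a product of two local terms over the columns of a strength-2 array
   therefore splits into a product of two sums over complete error bases, and
   the sum of E_i^* A E_i over an error basis is d tr(A) 1, which vanishes for
   traceless A.  A one-node term is the special case where the operator on the
   second node is the identity. *)
Require Import Defs.
From mathcomp Require Import all_boot all_order all_algebra.
From mathcomp Require Import complex reals.

Import Order.TTheory GRing.Theory Num.Theory.
Local Open Scope ring_scope.
Local Open Scope complex_scope.
Local Open Scope sesquilinear_scope.

(** By distributivity: a product over nodes of sums over intermediate levels expands into one sum
    over words. *)
Lemma tens_mul (K : comPzRingType) (n d : nat) (A B : 'I_n -> 'M[K]_d) :
  tens A *m tens B = tens (fun k => A k *m B k).
Proof.
apply/matrixP=> x y; rewrite !mxE.
under [RHS]eq_bigr do rewrite mxE.
rewrite bigA_distr_bigA /=.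
rewrite [RHS](reindex (fun z : 'I_(tdim n d) => enum_val z)) /=; last first.
  exact/onW_bij/enum_val_bij.
by apply: eq_bigr => z _; rewrite !mxE -big_split.
Qed.

Lemma tens_adjoint (K : numClosedFieldType) (n d : nat) (A : 'I_n -> 'M[K]_d) :
  (tens A)^t* = tens (fun k => (A k)^t*).
Proof.
apply/matrixP=> x y; rewrite !mxE rmorph_prod.
by apply: eq_bigr => k _; rewrite !mxE.
Qed.

Lemma on_node1 (K : comPzRingType) (n d : nat) (k : 'I_n) :
  on_node k (1%:M : 'M[K]_d) = 1%:M.
Proof.
apply/matrixP=> x y; rewrite !mxE.
under eq_bigr do rewrite if_same mxE.
have [->|neq_xy] := eqVneq x y; first by rewrite big1 // => i _; rewrite eqxx.
have /existsP[i neq_i] : [exists i, (enum_val x : {ffun 'I_n -> 'I_d}) i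
                            != (enum_val y : {ffun 'I_n -> 'I_d}) i].
  apply: contraNT neq_xy => /existsPn eq_xy; apply/eqP/enum_val_inj/ffunP=> i.
  by apply/eqP; rewrite -[_ == _]negbK eq_xy.
by rewrite (bigD1 i) //= (negPf neq_i) mul0r.
Qed.

(* The rows of V, the flattened E i, give V V^* = d; as V is square, also V^* V = d. *)
Lemma unitary_error_basis_complete (K : numClosedFieldType) (d : nat)
    (E : 'I_(d ^ 2) -> 'M[K]_d) (a b x y : 'I_d) :
  unitary_error_basis E ->
  \sum_i (E i a x)^* * E i b y = d%:R * ((a == b) && (x == y))%:R.
Proof.
case=> unitE orthE.
have d_neq0 : d%:R != 0 :> K by rewrite pnatr_eq0 -lt0n (leq_trans _ (ltn_ord a)).
(* [d ^ 2] and [d * d] are convertible, so the indices of [E] serve as row indices and [V] is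
   square. *)
pose V : 'M[K]_(d * d, d * d) := \matrix_i mxvec (E i).
have VV : V *m V^t* = d%:R%:M.
  apply/matrixP=> i j; rewrite !mxE.
  transitivity (\tr ((E j)^t* *m E i)).
    rewrite mxtrace_mulC (reindex _ (curry_mxvec_bij d d)) /=.
    transitivity (\sum_u \sum_v V i (mxvec_index u v) * V^t* (mxvec_index u v) j).
      by rewrite pair_bigA; apply: eq_bigr => -[u v].
    apply: eq_bigr => u _; rewrite mxE; apply: eq_bigr => v _.
    by rewrite !mxE !mxvecE.
  have [<-|neq_ij] := eqVneq i j.
    by rewrite mxtrace_mulC (unitarymxP (unitE i)) mxtrace1.
  have /eqP := orthE j i (etrans (congr1 negb (eq_sym j i)) neq_ij).
  by rewrite mulf_eq0 invr_eq0 (negPf d_neq0) orbF => /eqP.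
have : V^t* *m (d%:R^-1 *: V) = 1%:M.
  by apply: mulmx1C; rewrite -scalemxAl VV scale_scalar_mx mulVf.
(* The claim is the entry of this identity at row [(a, x)] and column [(b, y)], rescaled by [d]. *)
move=> /(congr1 (fun W : 'M_(_) => d%:R * W (mxvec_index a x) (mxvec_index b y))).
rewrite !mxE mulr_sumr => VE.
have -> : (a == b) && (x == y) = (mxvec_index a x == mxvec_index b y).
  by rewrite (inj_eq (@cast_ord_inj _ _ _)) (inj_eq enum_rank_inj) xpair_eqE.
rewrite -VE; apply: eq_bigr => i _.
by rewrite !mxE !mxvecE mulrCA mulVKf.
Qed.

(** In the [(x, y)] entry, the coefficient of [A a b] is the completeness sum, which survives only
    for [a = b] and [x = y]. *)
Lemma unitary_error_basis_twirl (K : numClosedFieldType) (d : nat)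
    (E : 'I_(d ^ 2) -> 'M[K]_d) (A : 'M[K]_d) :
  unitary_error_basis E ->
  \sum_i (E i)^t* *m A *m E i = (d%:R * \tr A)%:M.
Proof.
move=> ueE; apply/matrixP=> x y; rewrite summxE !mxE.
transitivity (\sum_b \sum_a A a b * \sum_i (E i a x)^* * E i b y).
  under eq_bigr do rewrite mxE.
  rewrite exchange_big; apply: eq_bigr => b _.
  under eq_bigr do rewrite mxE mulr_suml.
  rewrite exchange_big; apply: eq_bigr => a _; rewrite mulr_sumr.
  by apply: eq_bigr => i _; rewrite !mxE mulrAC mulrA [A a b * _]mulrC mulrAC.
rewrite [d%:R * _]mulr_sumr -sumrMnl; apply: eq_bigr => b _.
under eq_bigr do rewrite unitary_error_basis_complete //.
rewrite (bigD1 b) //= big1 => [|a /negPf->]; last by rewrite !mulr0.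
by rewrite eqxx addr0 mulrCA mulrA mulr_natr.
Qed.

(** Group the columns by the pair of symbols they carry in rows [k] and [l]: each class has [lambda]
    members. *)
Lemma orthogonal_array_sum (T : finType) (V : nmodType) (lambda n N : nat)
    (M : 'M[T]_(n, N)) (k l : 'I_n) (F : T -> T -> V) :
  orthogonal_array lambda M -> k != l ->
  \sum_j F (M k j) (M l j) = (\sum_a \sum_b F a b) *+ lambda.
Proof.
(* The array condition speaks of [k < l] only; the other order follows by swapping the arguments of
   [F]. *)
move=> oaM; wlog lt_kl : k l F / (k < l)%N => [IH neq_kl | _].
  have [lt_kl|lt_lk|/val_inj eq_kl] := ltngtP k l; first exact: IH.
    by rewrite (IH l k (fun a b => F b a)) 1?eq_sym // exchange_big.
  by rewrite eq_kl eqxx in neq_kl.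
rewrite pair_bigA /= -sumrMnl.
rewrite (partition_big (fun j => (M k j, M l j)) predT) //=.
apply: eq_bigr => -[a b] _ /=.
rewrite -(oaM k l lt_kl a b) -sumr_const.
apply: eq_big => [j|j]; first by rewrite inE xpair_eqE.
by rewrite xpair_eqE => /andP[/eqP-> /eqP->].
Qed.

(** [B] is left arbitrary so that [B = 1] covers the one-node terms. *)
Lemma orthogonal_array_decouples (K : numClosedFieldType) (lambda n N d : nat)
    (M : 'M['I_(d ^ 2)]_(n, N)) (E : 'I_n -> 'I_(d ^ 2) -> 'M[K]_d)
    (k l : 'I_n) (A B : 'M[K]_d) :
  orthogonal_array lambda M -> (forall i, unitary_error_basis (E i)) ->
  k != l -> \tr A = 0 ->
  \sum_j (tens (fun i => E i (M i j)))^t* *m (on_node k A *m on_node l B)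
           *m tens (fun i => E i (M i j)) = 0.
Proof.
move=> oaM ueE neq_kl trA0.
pose conj i (C : 'M[K]_d) a := (E i a)^t* *m C *m E i a.
have conj1 i a : conj i 1%:M a = 1%:M.
  by rewrite /conj mulmx1; apply/mulmx1C/unitarymxP; case: (ueE i).
apply/matrixP=> x y; rewrite summxE [RHS]mxE.
pose X := enum_val x : {ffun 'I_n -> 'I_d}.
pose Y := enum_val y : {ffun 'I_n -> 'I_d}.
(* The other nodes carry the identity, fixed by conjugation, so their contribution [c] is the same
   for all columns. [F a b] is the [(x, y)] entry of the conjugated operator for a column reading
   [a] at [k] and [b] at [l]. *)
pose c := \prod_(i < n | (i != k) && (i != l)) (1%:M : 'M[K]_d) (X i) (Y i).
pose F a b := conj k A a (X k) (Y k) * (conj l B b (X l) (Y l) * c).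
transitivity (\sum_j F (M k j) (M l j)).
  apply: eq_bigr => j _.
  rewrite tens_adjoint /on_node !tens_mul mxE (bigD1 k) //= (bigD1 l) 1?eq_sym //=.
  rewrite !eqxx [l == k]eq_sym (negPf neq_kl) mulmx1 mul1mx.
  congr (_ * (_ * _)); apply: eq_bigr => i /andP[/negPf-> /negPf->].
  by rewrite mulmx1 [_ *m _ *m _]conj1.
(* For fixed [b], the sum over [a] is an entry of the twirl of [A], which is zero since [A] has
   trace zero. *)
rewrite (orthogonal_array_sum _ _ _ _ _ _ _ _ F oaM neq_kl) exchange_big big1 ?mul0rn // => b _.
rewrite /F -mulr_suml -(summxE _ _ (conj k A)) unitary_error_basis_twirl //.
by rewrite trA0 mulr0 !mxE mul0rn mul0r.
Qed.

Theorem theorem1 (R : realType) (d n N lambda : nat)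
    (hd : (2 <= d)%N) (hn : (2 <= n)%N) (hlambda : (1 <= lambda)%N)
    (M : 'M['I_(d ^ 2)]_(n, N)) (hM : orthogonal_array lambda M)
    (E : 'I_n -> 'I_(d ^ 2) -> 'M[R[i]]_d)
    (hE : forall k : 'I_n, unitary_error_basis (E k))
    (sigma : 'I_(d ^ 2).-1 -> 'M[R[i]]_d)
    (hsigma : orthogonal_traceless_basis sigma)
    (H : 'M[R[i]]_(tdim n d)) (hH : pair_interaction sigma H) :
  let U (j : 'I_N) := tens (fun k : 'I_n => E k (M k j)) in
  N%:R^-1 *: (\sum_(j < N) ((U j)^t* *m H *m U j)) = 0.
Proof.
move=> U.
have tr0 a : \tr (sigma a) = 0 by case: hsigma => /(_ a)/andP[_ /eqP].
(* [T] is linear, so it is enough that it kills every term of [H]. *)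
pose T X := \sum_j (U j)^t* *m X *m U j.
have TD X Y : T X = 0 -> T Y = 0 -> T (X + Y) = 0.
  move=> TX0 TY0; rewrite -[RHS]addr0 -{1}TX0 -TY0 -big_split /=.
  by apply: eq_bigr => j _; rewrite mulmxDr mulmxDl.
have TZ z X : T X = 0 -> T (z *: X) = 0.
  move=> TX0; rewrite -[RHS](scaler0 _ z) -TX0 scaler_sumr.
  by apply: eq_bigr => j _; rewrite -scalemxAr -scalemxAl.
have T0 : T 0 = 0 by rewrite /T big1 // => j _; rewrite mulmx0 mul0mx.
have T_sum (I : finType) (P : pred I) X :
    (forall i, P i -> T (X i) = 0) -> T (\sum_(i | P i) X i) = 0.
  by move=> TX0; elim/big_ind: _.
case: hH => J [r [_ ->]]; rewrite -/(T _) TD ?scaler0 //.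
  do 2![apply: (T_sum) => ? ?]; do 2![apply: (T_sum) => ? _]; apply: TZ.
  exact: orthogonal_array_decouples hM hE _ _.
apply: (T_sum) => k _; apply: T_sum => a _; apply: TZ.
(* As [n >= 2], a second node exists: node 1 if [k] is node 0, and node 0 otherwise. *)
have [l neq_kl] : exists l : 'I_n, k != l.
  have n_gt0 : (0 < n)%N by apply: leq_trans hn.
  by have [->|] := eqVneq k (Ordinal n_gt0); [exists (Ordinal hn) | exists (Ordinal n_gt0)].
rewrite -[on_node k _]mulmx1 -(on_node1 _ _ _ l).
exact: orthogonal_array_decouples hM hE _ _.
Qed.
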